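(* Let $n\geq 4$ and let $\alpha,\beta\in\mathcal{AOR}_n$ be two elements of rank $n-1$. Then: (1) if $n\not\equiv 2\ (\mathrm{mod}\ 4)$, $\alpha\mathscr{J}\beta$ in $\mathcal{AOR}_n$; (2) if $n\equiv 2\ (\mathrm{mod}\ 4)$, $\alpha\mathscr{J}\beta$ in $\mathcal{AOR}_n$ if and only if $\mathrm{d}(\alpha)$ and $\mathrm{d}(\beta)$ have the same parity.
   Context: Let $\Omega_n=\{1<2<\cdots<n\}$ and let $\mathcal{I}_n$ be the symmetric inverse monoid on $\Omega_n$, i.e. the monoid of all injective partial maps (partial permutations) of $\Omega_n$ under composition of partial maps. The alternating inverse monoid is $\mathcal{AI}_n=\{\alpha\in\mathcal{I}_n : \alpha=\sigma|_{\mathrm{Dom}(\alpha)}\text{ for some even permutation }\sigma\text{ of }\Omega_n\}$. A partial permutation $\alpha$ with $\mathrm{Dom}(\alpha)=\{a_1<\cdots<a_t\}$, $t\geq 0$, is orientation-preserving [respectively, orientation-reversing] if there is at most one index $i\in\{1,\ldots,t\}$ with $a_i\alpha>a_{i+1}\alpha$ [respectively, $a_i\alpha<a_{i+1}\alpha$], where $a_{t+1}$ denotes $a_1$; it is oriented if it is orientation-preserving or orientation-reversing. $\mathcal{AOR}_n$ is the inverse submonoid of $\mathcal{I}_n$ of all oriented elements of $\mathcal{AI}_n$. The rank of $\alpha$ is $|\mathrm{Im}(\alpha)|$. For $\alpha$ of rank $n-1$, $\mathrm{d}(\alpha)$ is the unique element of $\Omega_n\setminus\mathrm{Dom}(\alpha)$.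 In a monoid $M$, $a\mathscr{J}b$ means $MaM=MbM$. *)

(* Defs.v *)
From HB Require Import structures.
From mathcomp Require Import all_boot all_fingroup.

Set Implicit Arguments.
Unset Strict Implicit.
Unset Printing Implicit Defensive.

Local Open Scope group_scope.

(* The chain Omega_n = {1 < ... < n} is represented by 'I_n, with i : 'I_n
   standing for the point i.+1; a partial map sends x to None when x is not in
   its domain. *)
Definition pinjective n (f : {ffun 'I_n -> option 'I_n}) : bool :=
  [forall x, forall y, (f x != None) ==> (f x == f y) ==> (x == y)].

Record pperm n := PPerm {
  pfun :> {ffun 'I_n -> option 'I_n};
  _ : pinjective pfun
}.

HB.instance Definition _ n := [isSub for @pfun n].
HB.instance Definition _ n := [Finite of pperm n by <:].

Lemma pinjectiveP n (f : {ffun 'I_n -> option 'I_n}) :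
  reflect (forall x y z, f x = Some z -> f y = Some z -> x = y) (pinjective f).
Proof.
apply: (iffP 'forall_forallP) => [inj_f x y z fx fy | inj_f x y].
  by move: (inj_f x y); rewrite fx fy eqxx /= => /eqP.
case fx: (f x) => [z|] //=; apply/implyP => /eqP fy.
by apply/eqP; apply: (inj_f x y z).
Qed.

(* Maps are written on the right: alpha * beta is alpha followed by beta. *)
Definition pcomp n (a b : pperm n) : {ffun 'I_n -> option 'I_n} :=
  [ffun x => obind b (a x)].

Lemma pcomp_inj n (a b : pperm n) : pinjective (pcomp a b).
Proof.
apply/pinjectiveP => x y z; rewrite !ffunE.
case ax: (a x) => [x'|] //= bx; case ay: (a y) => [y'|] //= by_.
have /pinjectiveP inj_a := valP a; have /pinjectiveP inj_b := valP b.
by apply: (inj_a _ _ x'); rewrite // ay (inj_b _ _ _ bx by_).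
Qed.

Definition pmul n (a b : pperm n) : pperm n := PPerm (pcomp_inj a b).

Lemma pid_inj n : pinjective [ffun x : 'I_n => Some x].
Proof. by apply/pinjectiveP => x y z; rewrite !ffunE => -[->] [->]. Qed.

Definition pone n : pperm n := PPerm (pid_inj n).

Lemma pmulA n : associative (@pmul n).
Proof.
move=> a b c; apply/val_inj/ffunP => x; rewrite !ffunE.
by case: (a x) => //= y; rewrite ffunE.
Qed.

Lemma pmul1 n : left_id (@pone n) (@pmul n).
Proof. by move=> a; apply/val_inj/ffunP => x; rewrite !ffunE. Qed.

Lemma pmulr1 n : right_id (@pone n) (@pmul n).
Proof.
move=> a; apply/val_inj/ffunP => x; rewrite !ffunE.
by case: (a x) => //= y; rewrite ffunE.
Qed.

HB.instance Definition _ n :=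
  isMonoid.Build (pperm n) (@pmulA n) (@pmul1 n) (@pmulr1 n).

Section PartialPermutations.

Variable n : nat.
Implicit Types a b : pperm n.

Definition pdom a : {set 'I_n} := [set x | a x != None].
Definition pim a : {set 'I_n} := [set y | [exists x, a x == Some y]].
Definition prank a : nat := #|pim a|.

(* The images a_1 alpha, ..., a_t alpha listed along a_1 < ... < a_t, as enum
   lists 'I_n in increasing order. *)
Definition pimages a : seq 'I_n := pmap a (enum 'I_n).

(* Consecutive pairs (a_i alpha, a_{i+1} alpha), cyclically (a_{t+1} = a_1). *)
Definition cyc_pairs a : seq ('I_n * 'I_n) :=
  zip (pimages a) (rot 1 (pimages a)).

Definition orientation_preserving a : bool :=
  (count (fun p : 'I_n * 'I_n => p.1 > p.2) (cyc_pairs a) <= 1)%N.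

Definition orientation_reversing a : bool :=
  (count (fun p : 'I_n * 'I_n => p.1 < p.2) (cyc_pairs a) <= 1)%N.

Definition oriented a : bool :=
  orientation_preserving a || orientation_reversing a.

Definition AI : {set pperm n} :=
  [set a | [exists s : 'S_n,
     ~~ odd_perm s && [forall x in pdom a, a x == Some (s x)]]].

Definition AOR : {set pperm n} := [set a in AI | oriented a].

(* M a M *)
Definition two_sided_ideal (M : {set pperm n}) a : {set pperm n} :=
  [set u * a * v | u : pperm n in M, v : pperm n in M].

Definition Jrel (M : {set pperm n}) a b : Prop :=
  two_sided_ideal M a = two_sided_ideal M b.

(* The label in {1, ..., n} of the point missing from the domain. The value is
   only meaningful when a has rank n - 1, cf. dP; it is 0 when a is total. *)
Definition d a : nat :=
  if [pick x | x \notin pdom a] is Some x then x.+1 else 0.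

Lemma card_pdom a : #|pdom a| = prank a.
Proof.
have injS : injective (@Some 'I_n) by move=> x y [].
have /pinjectiveP inj_a := valP a.
rewrite /prank -(card_imset (pim a) injS) -(card_in_imset (f := a) (D := pdom a)).
  apply: eq_card => o; apply/imsetP/imsetP => [[x]|[y]]; rewrite inE.
    case ax: (a x) => [y|] // _ ->; exists y => //.
    by rewrite inE; apply/existsP; exists x; rewrite ax.
  by case/existsP=> x /eqP ax ->; exists x; rewrite ?inE ax.
move=> x y; rewrite !inE; case ax: (a x) => [z|] // _ _ eq_az.
by apply: (inj_a _ _ z).
Qed.

Lemma dP a : 0 < n -> prank a = n.-1 ->
  exists2 x : 'I_n, ~: pdom a = [set x] & d a = x.+1.
Proof.
move=> n_gt0 rk_a; have /eqP/cards1P[x def_x] : #|~: pdom a| = 1%N.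
  rewrite cardsCs setCK card_pdom rk_a card_ord.
  by rewrite -{1}(prednK n_gt0) subSnn.
exists x => //; rewrite /d; case: pickP => [y|/(_ x)].
  by rewrite -in_setC def_x => /set1P->.
by rewrite -in_setC def_x set11.
Qed.

End PartialPermutations.

Arguments AI n : clear implicits.
Arguments AOR n : clear implicits.

(* Main.v *)
(* Orientation-preserving (reversing) means preserving (reversing) the ternary
   cyclic order on the domain, a condition visibly stable under products and
   inverses. The rank n-1 partial permutations of Omega_n that are oriented, with
   domain Omega_n \ {i} and image Omega_n \ {j}, therefore come from an element
   s of the dihedral group on n-1 points, and the unique completion of such a
   map to a permutation of Omega_n has sign (-1)^(i+j) * sgn s. Hence i and j are
   J-related iff some dihedral s has sign (-1)^(i+j). The dihedral group on n-1
   points contains an odd permutation iff n-1 is not 1 mod 4: the rotation is an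
   (n-1)-cycle and the reversal a product of floor((n-1)/2) transpositions. *)
Require Import Defs.
From mathcomp Require Import all_boot all_fingroup zify.

Set Implicit Arguments.
Unset Strict Implicit.
Unset Printing Implicit Defensive.

(** * Cyclic order on the naturals and lists with at most one cyclic descent *)

(** Strict: for distinct points exactly one of [cyc x y z] and [cyc z y x] holds, and neither holds
    when two points coincide. *)
Definition cyc (x y z : nat) : bool :=
  [|| x < y < z, y < z < x | z < x < y].

Definition descents (s : seq nat) : nat :=
  count (fun p : nat * nat => p.1 > p.2) (zip s (rot 1 s)).

(** One rotation step moves the leading cyclic pair to the end of the list of pairs, and [count]
    ignores order. *)
Lemma descents_rot k s : descents (rot k s) = descents s.
Proof.
elim: k => [|k IHk]; first by rewrite rot0.
have [lt_k|le_k] := ltnP k (size s); last first.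
  by rewrite !rot_oversize // ltnW.
rewrite rotS // -{}IHk; case: (rot k s) => [|x [|y t]] //.
have zip_cons u v : zip (x :: u) (y :: v) = (x, y) :: zip u v by [].
rewrite /descents !rot1_cons rcons_cons -[y :: _]rcons_cons.
by rewrite zip_rcons ?size_rcons // zip_cons -cats1 count_cat /= addn0 addnC.
Qed.

Lemma count_zip_rcons x y t :
  count (fun p : nat * nat => p.1 > p.2) (zip (x :: t) (rcons t y))
  = count (fun p : nat * nat => p.1 > p.2) (zip (x :: t) t) + (last x t > y).
Proof.
elim: t x => [|z t IHt] x; first by rewrite /= addn0.
by rewrite rcons_cons /= in IHt *; rewrite IHt addnA.
Qed.

Lemma no_descents x t : uniq (x :: t) ->
  (count (fun p : nat * nat => p.1 > p.2) (zip (x :: t) t) == 0) = path ltn x t.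
Proof.
elim: t x => [|y t IHt] x //= /andP[]; rewrite inE negb_or => /andP[ne_xy _] Ut.
rewrite -IHt // addn_eq0 eqb0 -leqNgt leq_eqVlt.
by rewrite (negPf ne_xy).
Qed.

Lemma descents_path x t : uniq (x :: t) -> all (ltn x) t ->
  (descents (x :: t) <= 1) = path ltn x t.
Proof.
move=> Us min_x; rewrite /descents rot1_cons count_zip_rcons -no_descents //.
(* The only cyclic pair of a singleton is [(x, x)], no descent; in a longer list the closing pair
   descends onto the minimum and uses up the bound. *)
case: t min_x {Us} => [|y t] min_x; first by rewrite /= ltnn.
have /= -> := allP min_x _ (mem_last y t).
by rewrite addn1 ltnS leqn0.
Qed.

Lemma rot_min (s : seq nat) : uniq s -> s != [::] ->
  exists k x t, [/\ k < size s, rot k s = x :: t & all (ltn x) t].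
Proof.
move=> Us; case Es: s => [|z r] // _; rewrite -Es.
have ex_m: exists m, m \in s by exists z; rewrite Es mem_head.
case: (ex_minnP ex_m) => m ms min_m.
exists (index m s), m, (drop (index m s).+1 s ++ take (index m s) s).
rewrite index_mem ms rot_index //; split => //.
have := Us; rewrite -(rot_uniq (index m s)) rot_index //= => /andP[m_notin _].
apply/allP => y yr /=; rewrite ltn_neqAle; apply/andP; split.
  by apply: contraNneq m_notin => {1}->.
by apply: min_m; rewrite -(mem_rot (index m s)) rot_index // inE yr orbT.
Qed.

Lemma nth_rot x0 k i (s : seq nat) : k < size s -> i < size s ->
  nth x0 (rot k s) i =
  nth x0 s (if i < size s - k then k + i else i - (size s - k)).
Proof.
move=> lt_k lt_i; rewrite /rot nth_cat size_drop nth_drop.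
by case: ltnP => // le_i; rewrite nth_take //; lia.
Qed.

Definition nth_cyc (s : seq nat) : Prop :=
  forall i j k, i < size s -> j < size s -> k < size s ->
    cyc i j k -> cyc (nth 0 s i) (nth 0 s j) (nth 0 s k).

Lemma nth_cyc_rot k s : k < size s -> nth_cyc s -> nth_cyc (rot k s).
Proof.
move=> lt_k cyc_s a b c; rewrite size_rot => lt_a lt_b lt_c cyc_abc.
rewrite !nth_rot //; apply: cyc_s;
  by move: cyc_abc; rewrite /cyc; repeat case: ifP => ?; lia.
Qed.

(* Rotate the list so that its minimum comes first: the descent onto the minimum
   is then the only one allowed, so the rotated list must be increasing. *)
Lemma descentsP (s : seq nat) : uniq s -> descents s <= 1 <-> nth_cyc s.
Proof.
move=> Us; case Es: (s != [::]); last first.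
  by case: s {Us} Es => // _; split=> // _ i.
have [k [x [t [lt_k def_s' min_x]]]] := rot_min Us Es.
have Us': uniq (x :: t) by rewrite -def_s' rot_uniq.
rewrite -(descents_rot k) def_s' descents_path //.
have ->: nth_cyc s <-> nth_cyc (x :: t).
  rewrite -def_s'; split; first exact: nth_cyc_rot.
  have [-> | k_gt0] := posnP k; first by rewrite rot0.
  move/(@nth_cyc_rot (size s - k)); rewrite size_rot.
  rewrite -{3}(size_rot k s) -/(rotr k _) rotK.
  by apply; lia.
have ltn_tr : transitive ltn by move=> b a c; apply: ltn_trans.
split=> [sorted_s a b c lt_a lt_b lt_c | cyc_s].
  have mono_s := sorted_ltn_nth ltn_tr 0 (s := x :: t) sorted_s.
  by case/or3P=> /andP[]; do 2![move/mono_s=> /(_ ltac:(by []) ltac:(by [])) /= ?];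
    rewrite /cyc; lia.
apply/(pathP 0) => -[|i] lt_i; first exact: (allP min_x _ (mem_nth 0 lt_i)).
have cyc_i : cyc 0 i.+1 i.+2 by rewrite /cyc; lia.
have := cyc_s 0 i.+1 i.+2 isT (ltnW lt_i) lt_i cyc_i.
have /= := allP min_x _ (mem_nth 0 lt_i).
by rewrite /cyc /=; lia.
Qed.

(** * Orientation as preservation or reversal of the cyclic order *)

(** The flag is a sign in Z/2: composing maps adds flags by [(+)]. *)
Definition cycb (b : bool) (x y z : nat) : bool :=
  if b then cyc z y x else cyc x y z.

Definition orients n (b : bool) (a : pperm n) : Prop :=
  forall x y z x' y' z', a x = Some x' -> a y = Some y' -> a z = Some z' ->
    cyc x y z -> cycb b x' y' z'.

Lemma pmap_map_filter (T U : eqType) (f : T -> option U) (h : T -> U) s :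
  (forall x y, f x = Some y -> h x = y) ->
  pmap f s = map h (filter f s).
Proof.
by move=> fh; elim: s => //= x s ->; case fx: (f x) => [y|] //=; rewrite (fh x y).
Qed.

(** The enumeration [e] of the domain is increasing, so positions in it have the same cyclic order
    as the points they hold, and [descentsP] applies. The relabelling [g] serves both orientations:
    [val] for preserving, [rev_ord] for reversing. *)
Lemma descents_pimages n (a : pperm n) (g : 'I_n -> nat) : injective g ->
  descents (map g (pimages a)) <= 1 <->
  (forall x y z x' y' z', a x = Some x' -> a y = Some y' -> a z = Some z' ->
     cyc x y z -> cyc (g x') (g y') (g z')).
Proof.
move=> g_inj; have /pinjectiveP a_inj := valP a.
pose h (x : 'I_n) := odflt x (a x).
pose e := filter (fun x : 'I_n => a x : bool) (enum 'I_n).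
have hE x y : a x = Some y -> h x = y by rewrite /h => ->.
have def_a : pimages a = map h e by apply: pmap_map_filter.
have e_dom x : x \in e = (a x : bool) by rewrite mem_filter mem_enum andbT.
have nth_h x0 i : i < size e -> a (nth x0 e i) = Some (h (nth x0 e i)).
  by move/(mem_nth x0); rewrite e_dom /h; case: (a _).
have Ue : uniq e by rewrite filter_uniq // enum_uniq.
have Us : uniq (map g (map h e)).
  rewrite map_inj_uniq // map_inj_in_uniq // => x y.
  rewrite !e_dom /h; case ax: (a x) => [u|] //; case ay: (a y) => [v|] //= _ _ def_u.
  by apply: (a_inj _ _ u); rewrite // ay def_u.
have ltn_tr : transitive ltn by move=> v u w; apply: ltn_trans.
have sorted_e : sorted ltn (map val e).
  rewrite sorted_map; apply: sorted_filter; first by move=> v u w; apply: ltn_trans.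
  by rewrite -sorted_map val_enum_ord iota_ltn_sorted.
have nth_e x0 i j : i < size e -> j < size e -> (nth x0 e i < nth x0 e j) = (i < j).
  move=> lt_i lt_j; have mono_e := sorted_ltn_nth ltn_tr 0 sorted_e.
  have lt_nth u v : u < size e -> v < size e -> u < v -> nth x0 e u < nth x0 e v.
    by move=> lt_u lt_v /mono_e; rewrite !inE size_map !(nth_map x0) //; apply.
  apply/idP/idP => [|/lt_nth-> //]; apply: contraTT; rewrite -!leqNgt leq_eqVlt.
  by case/predU1P=> [-> //|/lt_nth/ltnW->].
have cyc_nth x0 i j k : i < size e -> j < size e -> k < size e ->
    cyc (nth x0 e i) (nth x0 e j) (nth x0 e k) = cyc i j k.
  by move=> lt_i lt_j lt_k; rewrite /cyc !nth_e.
rewrite def_a descentsP // /nth_cyc !size_map; split.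
  move=> cyc_s x y z x' y' z' ax ay az cyc_xyz.
  have ex : x \in e by rewrite e_dom ax.
  have ey : y \in e by rewrite e_dom ay.
  have ez : z \in e by rewrite e_dom az.
  rewrite -(hE _ _ ax) -(hE _ _ ay) -(hE _ _ az).
  rewrite -(nth_index x ex) -(nth_index x ey) -(nth_index x ez) in cyc_xyz *.
  rewrite cyc_nth ?index_mem // in cyc_xyz.
  have := cyc_s _ _ _ _ _ _ cyc_xyz.
  by rewrite !index_mem -map_comp !(nth_map x) ?index_mem //; apply.
move=> cyc_a i j k lt_i lt_j lt_k cyc_ijk.
have x0 : 'I_n by case: (e) lt_i => [|x].
rewrite -map_comp !(nth_map x0) //=.
by apply: cyc_a; try exact: nth_h; rewrite cyc_nth.
Qed.

Lemma orientation_preservingP n (a : pperm n) :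
  orientation_preserving a <-> orients false a.
Proof.
rewrite /orients -(descents_pimages a val_inj) /descents -map_rot.
have ->: zip [seq val i | i <- pimages a] [seq val i | i <- rot 1 (pimages a)]
   = [seq (val p.1, val p.2) | p <- cyc_pairs a].
  rewrite /cyc_pairs; elim: (pimages a) (rot 1 _) => [|x s IHs] [|y t] //=.
  by rewrite IHs.
by rewrite count_map.
Qed.

Lemma orientation_reversingP n (a : pperm n) :
  orientation_reversing a <-> orients true a.
Proof.
have r_inj : injective (fun x : 'I_n => rev_ord x : nat).
  by move=> x y /val_inj/rev_ord_inj.
have ->: orients true a <->
    descents (map (fun x : 'I_n => rev_ord x : nat) (pimages a)) <= 1.
  rewrite (descents_pimages a r_inj); split;
  move=> cyc_a x y z x' y' z' ax ay az cyc_xyz;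
  have := cyc_a _ _ _ _ _ _ ax ay az cyc_xyz; rewrite /cycb /cyc /=;
  move: (ltn_ord x') (ltn_ord y') (ltn_ord z'); lia.
rewrite /descents -map_rot.
have ->: zip [seq (rev_ord x : nat) | x <- pimages a]
             [seq (rev_ord x : nat) | x <- rot 1 (pimages a)]
   = [seq (rev_ord p.1 : nat, rev_ord p.2 : nat) | p <- cyc_pairs a].
  rewrite /cyc_pairs; elim: (pimages a) (rot 1 _) => [|x s IHs] [|y t] //=.
  by rewrite IHs.
rewrite count_map /orientation_reversing.
rewrite (@eq_count _ _ (fun p : 'I_n * 'I_n => p.1 < p.2)) //.
by move=> [x y] /=; move: (ltn_ord x) (ltn_ord y); lia.
Qed.

(** Both directions are assumed because [b] decides how the intermediate triple is traversed. *)
Lemma cycb_add b c x y z x' y' z' :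
    (cyc x y z -> cycb c x' y' z') -> (cyc z y x -> cycb c z' y' x') ->
  cycb b x y z -> cycb (b (+) c) x' y' z'.
Proof. by case: b; case: c. Qed.

(** Distinct points are cyclically ordered in one of two directions; the wrong one would be mapped
    to the reverse of [cyc x' y' z'], against asymmetry. *)
Lemma cycb_inv b x y z x' y' z' :
    [&& x != y, y != z & z != x] -> (cyc x y z -> cycb b x' y' z') ->
    (cyc z y x -> cycb b z' y' x') ->
  cyc x' y' z' -> cycb b x y z.
Proof.
move=> ne_xyz; have: cyc x y z || cyc z y x by move: ne_xyz; rewrite /cyc; lia.
have asym: cyc x' y' z' -> ~~ cyc z' y' x' by rewrite /cyc; lia.
rewrite /cycb; case: b; case: (cyc x y z); case: (cyc z y x) => //= _ h h' c';
  by move: (asym c'); rewrite ?h ?h'.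
Qed.

(** * Closure of [AOR] and membership in its two-sided ideals *)

Section OrientedMonoid.

Variable n : nat.
Implicit Types a b : pperm n.

Lemma pmulP a b x z :
  (a * b)%g x = Some z <-> exists2 y, a x = Some y & b y = Some z.
Proof.
rewrite ffunE; case: (a x) => [y|] /=; last by split=> // -[].
by split=> [by_|[_ [<-]]] //; exists y.
Qed.

Lemma pinv_subproof a : pinjective [ffun y => [pick x | a x == Some y]].
Proof.
apply/pinjectiveP => y z x; rewrite !ffunE.
case: pickP => // u /eqP au [<-]; case: pickP => // v /eqP av [eq_vu].
by move: av; rewrite eq_vu au => -[].
Qed.

Definition pinv a : pperm n := PPerm (pinv_subproof a).

Lemma pinvP a x y : pinv a y = Some x <-> a x = Some y.
Proof.
have /pinjectiveP a_inj := valP a.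
rewrite ffunE; case: pickP => [u /eqP au | no_x]; last first.
  by split=> // ax; have /eqP := no_x x.
split=> [[<-] // | ax]; by rewrite (a_inj _ _ _ au ax).
Qed.

Lemma orients_mul (b c : bool) a a' :
  orients b a -> orients c a' -> orients (b (+) c) (a * a')%g.
Proof.
move=> ob oc x y z x2 y2 z2 /pmulP[x1 ax bx] /pmulP[y1 ay by_] /pmulP[z1 az bz] cyc0.
apply: cycb_add (ob _ _ _ _ _ _ ax ay az cyc0) => cyc1.
  exact: oc bx by_ bz cyc1.
exact: oc bz by_ bx cyc1.
Qed.

Lemma orients_inv (b : bool) a : orients b a -> orients b (pinv a).
Proof.
move=> ob x y z x' y' z' /pinvP ax /pinvP ay /pinvP az cyc0.
apply: cycb_inv (cyc0); [|exact: ob ax ay az|exact: ob az ay ax].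
have ne u v u' v' : a u' = Some u -> a v' = Some v -> u != v :> nat -> u' != v' :> nat.
  move=> au av; apply: contraNneq => /val_inj eq_uv.
  by move: au; rewrite eq_uv av => -[->].
move: cyc0; rewrite /cyc => cyc0.
by rewrite (ne _ _ _ _ ax ay) ?(ne _ _ _ _ ay az) ?(ne _ _ _ _ az ax); lia.
Qed.

Lemma AORP a :
  a \in AOR n <->
  (exists2 s : 'S_n, ~~ odd_perm s & forall x y, a x = Some y -> s x = y)
  /\ exists b : bool, orients b a.
Proof.
rewrite inE; split=> [/andP[]|[[s even_s a_s] [b oa]]].
  rewrite inE => /existsP[s /andP[even_s /forall_inP a_s]] or_a; split.
    by exists s => // x y ax; have := a_s x; rewrite inE ax => /(_ isT)/eqP[->].
  case/orP: or_a => [/orientation_preservingP|/orientation_reversingP] oa.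
    by exists false.
  by exists true.
apply/andP; split.
  rewrite inE; apply/existsP; exists s; rewrite even_s; apply/forall_inP => x.
  by rewrite inE; case ax: (a x) => [y|] // _; rewrite (a_s _ _ ax).
apply/orP; case: b oa => oa; [right; exact/orientation_reversingP|].
by left; apply/orientation_preservingP.
Qed.

Lemma AOR1 : 1%g \in AOR n.
Proof.
apply/AORP; split; first exists 1%g.
- by rewrite odd_perm1.
- by move=> x y; rewrite ffunE perm1 => -[].
by exists false => x y z x' y' z'; rewrite !ffunE => -[<-] [<-] [<-].
Qed.

Lemma AOR_mul a b : a \in AOR n -> b \in AOR n -> (a * b)%g \in AOR n.
Proof.
move=> /AORP[[s even_s a_s] [c oa]] /AORP[[t even_t b_t] [e ob]].
apply/AORP; split; last by exists (c (+) e); apply: orients_mul.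
exists (s * t)%g; first by rewrite odd_permM (negPf even_s).
by move=> x z /pmulP[y /a_s <- /b_t <-]; rewrite permM.
Qed.

Lemma AOR_inv a : a \in AOR n -> pinv a \in AOR n.
Proof.
move=> /AORP[[s even_s a_s] [c oa]].
apply/AORP; split; last by exists c; apply: orients_inv.
exists s^-1%g; first by rewrite odd_permV.
by move=> y x /pinvP/a_s <-; rewrite permK.
Qed.

Lemma Jrel_AOR a b : Jrel (AOR n) a b <->
  a \in two_sided_ideal (AOR n) b /\ b \in two_sided_ideal (AOR n) a.
Proof.
have ideal_id c : c \in two_sided_ideal (AOR n) c.
  by apply/imset2P; exists 1%g 1%g; rewrite ?AOR1 // mul1g mulg1.
have sub c e : c \in two_sided_ideal (AOR n) e ->
    two_sided_ideal (AOR n) c \subset two_sided_ideal (AOR n) e.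
  case/imset2P=> u v uM vM ->; apply/subsetP => _ /imset2P[u' v' u'M v'M ->].
  apply/imset2P; exists (u' * u)%g (v * v')%g; rewrite ?AOR_mul //.
  by rewrite !mulgA.
split=> [eq_ab | [/sub sub_ab /sub sub_ba]].
  by split; [rewrite -eq_ab | rewrite eq_ab].
by apply/eqP; rewrite eqEsubset sub_ab.
Qed.

(** The identity behind this is [a = c * b * (pinv b * (pinv c * a))]: [b * pinv b] fixes the domain
    of [b], which contains the image of [c], and [c * pinv c] fixes the domain of [c], which
    contains that of [a]. *)
Lemma AOR_ideal_transport c a b : c \in AOR n -> a \in AOR n -> b \in AOR n ->
    (forall x, c x = None -> a x = None) ->
    (forall y, b y = None -> pinv c y = None) ->
  a \in two_sided_ideal (AOR n) b.
Proof.
move=> cM aM bM dom_c dom_b; apply/imset2P.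
exists c (pinv b * (pinv c * a))%g; rewrite ?AOR_mul ?AOR_inv //.
apply/val_inj/ffunP => x; rewrite !ffunE.
case cx: (c x) => [y|] /=; last exact: dom_c.
have cy : pinv c y = Some x by apply/pinvP.
case by_: (b y) => [z|] /=; last by move/dom_b: by_; rewrite cy.
have bz : pinv b z = Some y by apply/pinvP.
by rewrite ffunE bz /= ffunE cy.
Qed.

End OrientedMonoid.

(** * The dihedral group and the signs of its elements *)

Definition perm_orients n (b : bool) (s : 'S_n) : Prop :=
  forall x y z : 'I_n, cyc x y z -> cycb b (s x) (s y) (s z).

Lemma perm_orients_mul n b c (s t : 'S_n) :
  perm_orients b s -> perm_orients c t -> perm_orients (b (+) c) (s * t)%g.
Proof.
move=> os ot x y z cyc0; rewrite !permM.
by apply: cycb_add (os _ _ _ cyc0); apply: ot.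
Qed.

Lemma perm_orients_inv n b (s : 'S_n) : perm_orients b s -> perm_orients b s^-1%g.
Proof.
move=> os x y z cyc0; apply: cycb_inv (cyc0);
  try by move/os; rewrite !permKV.
rewrite !(inj_eq val_inj) !(inj_eq perm_inj) -!(inj_eq val_inj) /=.
by move: cyc0; rewrite /cyc; lia.
Qed.

Lemma perm_orients_exp n (s : 'S_n) k :
  perm_orients false s -> perm_orients false (s ^+ k)%g.
Proof.
move=> os; elim: k => [|k IHk]; first by move=> x y z; rewrite !expg0 !perm1.
by rewrite expgS; apply: (perm_orients_mul os IHk).
Qed.

Lemma cyc_lift n (i : 'I_n.+1) (x y z : 'I_n) :
  cyc (lift i x) (lift i y) (lift i z) = cyc x y z.
Proof. by rewrite /cyc /= /bump; lia. Qed.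

(** Written through [lift_perm] so that [odd_lift_perm] gives the sign of this cycle directly. *)
Definition rotation n : 'S_n.+1 := lift_perm ord_max ord0 1%g.

Lemma rotationE n (x : 'I_n.+1) :
  rotation n x = (if x == n :> nat then 0 else x.+1) :> nat.
Proof.
case: (unliftP ord_max x) => [k|] ->; last by rewrite lift_perm_id eqxx.
by rewrite lift_perm_lift perm1 lift0 lift_max ltn_eqF.
Qed.

Lemma odd_rotation n : odd_perm (rotation n) = odd n.
Proof. by rewrite odd_lift_perm odd_perm1 /= !addbF. Qed.

Lemma perm_orients_rotation n : perm_orients false (rotation n).
Proof.
move=> x y z; rewrite /cycb /cyc !rotationE.
move: (ltn_ord x) (ltn_ord y) (ltn_ord z).
by do 3!case: eqP => ?; lia.
Qed.

Lemma rotationX n k : k <= n -> (rotation n ^+ k)%g ord0 = k :> nat.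
Proof.
elim: k => [|k IHk] lt_k; first by rewrite expg0 perm1.
by rewrite expgSr permM rotationE IHk 1?ltnW // ltn_eqF.
Qed.

(** By induction an increasing permutation sends no point below itself; the same bound for the
    inverse gives equality. *)
Lemma mono_perm1 n (s : 'S_n) :
  (forall x y : 'I_n, x < y -> s x < s y) -> s = 1%g.
Proof.
have ge_id (t : 'S_n) : (forall x y : 'I_n, x < y -> t x < t y) ->
    forall x : 'I_n, x <= t x.
  move=> mono_t [k]; elim: k => //= k IHk lt_k.
  by apply: leq_ltn_trans (IHk (ltnW lt_k)) (mono_t _ _ _).
move=> mono_s; apply/permP => x; rewrite perm1; apply/val_inj/eqP.
rewrite eqn_leq ge_id // andbT.
have mono_sV : forall x y : 'I_n, x < y -> s^-1%g x < s^-1%g y.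
  move=> u v lt_uv; rewrite ltnNge leq_eqVlt.
  apply/negP => /predU1P[/val_inj/perm_inj eq_vu|].
    by rewrite eq_vu ltnn in lt_uv.
  by move/mono_s; rewrite !permKV ltnNge ltnW.
by have := ge_id _ mono_sV (s x); rewrite permK.
Qed.

(** Dividing by the rotation power that agrees with [s] at [ord0] leaves a [t] that fixes the
    minimum; cyclic triples starting at [ord0] then make [t] increasing, hence trivial. *)
Lemma perm_orients_rotP n (s : 'S_n.+1) :
  perm_orients false s -> s = (rotation n ^+ s ord0)%g.
Proof.
move=> os; apply/eqP; rewrite eq_mulgV1; apply/eqP/mono_perm1.
set t := (_ * _)%g => x y lt_xy.
have ot : perm_orients false t.
  apply: (perm_orients_mul os); apply: perm_orients_inv.
  exact/perm_orients_exp/perm_orients_rotation.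
have t0 : t ord0 = ord0.
  rewrite permM; apply: (canLR (permK _)); apply/val_inj.
  by rewrite /= rotationX // -ltnS.
have [x0|x_gt0] := posnP x.
  have -> : x = ord0 by apply: val_inj.
  rewrite t0 lt0n; apply/negP => /eqP ty0.
  have /perm_inj eq_y0 : t y = t ord0 by rewrite t0; apply: val_inj.
  by rewrite eq_y0 in lt_xy.
have /ot : cyc (ord0 : 'I_n.+1) x y by rewrite /cyc /= x_gt0 lt_xy.
by rewrite t0 /cycb /cyc /=; lia.
Qed.

Definition reversal n : 'S_n := perm (@rev_ord_inj n).

(** The larger reversal sends the first point to the last and reverses the other [n]; moving
    position 0 to position [n] contributes the sign [odd n]. *)
Lemma odd_reversalS n : odd_perm (reversal n.+1) = odd n (+) odd_perm (reversal n).
Proof.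
have -> : reversal n.+1 = lift_perm ord0 ord_max (reversal n).
  apply/permP => x; apply/val_inj; rewrite permE.
  case: (unliftP ord0 x) => [k|] ->; last by rewrite lift_perm_id /= subn1.
  by rewrite lift_perm_lift permE /= /bump /=; move: (ltn_ord k); lia.
by rewrite odd_lift_perm.
Qed.

Lemma odd_reversal n : odd_perm (reversal n) = (1 < n %% 4).
Proof.
have odd_rev q r : r < 4 -> odd_perm (reversal (q * 4 + r)) = (1 < r).
  (* Four consecutive sizes contribute two odd terms, which cancel, so the parity has period
     four. *)
  move=> lt_r4; elim: q => [|q IHq]; last first.
    by rewrite mulSn -addnA !addSn add0n !odd_reversalS IHq /=; case: odd; case: (1 < r).
  have rev0: odd_perm (reversal 0) = false.
    by rewrite [reversal 0](_ : _ = 1%g) ?odd_perm1 //; apply/permP => -[].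
  by case: r lt_r4 => [|[|[|[|r]]]] // _; rewrite mul0n add0n ?odd_reversalS rev0.
by have := odd_rev (n %/ 4) (n %% 4); rewrite -divn_eq ltn_mod; apply.
Qed.

Lemma perm_orients_reversal n : perm_orients true (reversal n).
Proof.
move=> x y z; rewrite /cycb /cyc !permE /=.
by move: (ltn_ord x) (ltn_ord y) (ltn_ord z); lia.
Qed.

(** For [n] congruent to 1 mod 4 the rotation is a cycle of odd length, hence even, and the reversal
    is even too; together they generate all orienting permutations. *)
Lemma perm_orients_even n b (s : 'S_n) :
  n = 1 %[mod 4] -> perm_orients b s -> ~~ odd_perm s.
Proof.
case: n s => // n s n_mod.
have even_rot : odd_perm (rotation n) = false by rewrite odd_rotation; lia.
have even_pres (t : 'S_n.+1) : perm_orients false t -> ~~ odd_perm t.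
  move=> ot; rewrite (perm_orients_rotP ot); elim: (nat_of_ord _) => [|k IHk].
    by rewrite expg0 odd_perm1.
  by rewrite expgS odd_permM even_rot.
case: b => os; last exact: even_pres.
have := even_pres _ (perm_orients_mul os (@perm_orients_reversal n.+1)).
by rewrite odd_permM odd_reversal n_mod addbF.
Qed.

Lemma perm_orients_parity n (e : bool) : 0 < n -> n <> 1 %[mod 4] ->
  exists b (s : 'S_n), perm_orients b s /\ odd_perm s = e.
Proof.
move=> n_gt0 n_mod; case: e; last first.
  exists false, 1%g; split; last exact: odd_perm1.
  by move=> x y z; rewrite !perm1.
(* There are now [n.+1] points: for [n] odd the rotation is odd; otherwise [n.+1] must be 3 mod 4,
   where the reversal is odd. *)
case: n n_gt0 n_mod => // n _ n_mod; case odd_n: (odd n).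
  exists false, (rotation n); rewrite odd_rotation; split=> //.
  exact: perm_orients_rotation.
exists true, (reversal n.+1); split; first exact: perm_orients_reversal.
by rewrite odd_reversal; lia.
Qed.

(** * Elements of rank n-1 and the ideals they generate *)

Definition prestr n (s : 'S_n) (i : 'I_n) : {ffun 'I_n -> option 'I_n} :=
  [ffun x => if x == i then None else Some (s x)].

Lemma prestr_inj n (s : 'S_n) i : pinjective (prestr s i).
Proof.
apply/pinjectiveP => x y z; rewrite !ffunE.
by do 2!case: eqP => // _; move=> [<-] [/perm_inj].
Qed.

Definition perm_restr n (s : 'S_n) i : pperm n := PPerm (prestr_inj s i).

(** The parity of [lift_perm i j s] is [odd i (+) odd j (+) odd_perm s], so the assumed sign makes
    the completion even; [lift] is increasing, so the orientation of [s] survives. *)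
Lemma perm_restr_AOR n b (s : 'S_n) (i j : 'I_n.+1) :
  perm_orients b s -> odd_perm s = odd i (+) odd j ->
  perm_restr (lift_perm i j s) i \in AOR n.+1.
Proof.
move=> os odd_s; set t := lift_perm i j s; apply/AORP; split.
  exists t; first by rewrite odd_lift_perm odd_s addbb.
  by move=> x y; rewrite ffunE; case: eqP => // _ [].
exists b => x y z x' y' z'; rewrite !ffunE.
case: (unliftP i x) => [u|] ->; last by rewrite eqxx.
case: (unliftP i y) => [v|] ->; last by rewrite eqxx.
case: (unliftP i z) => [w|] ->; last by rewrite eqxx.
rewrite !(eq_sym _ i) !(negPf (neq_lift _ _)) !lift_perm_lift => -[<-] [<-] [<-].
by rewrite cyc_lift => /os; rewrite /cycb !cyc_lift.
Qed.

Lemma lift_perm_surj n (s : 'S_n.+1) (i : 'I_n.+1) :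
  exists t : 'S_n, s = lift_perm i (s i) t.
Proof.
pose f k := odflt k (unlift (s i) (s (lift i k))).
have lift_f k : lift (s i) (f k) = s (lift i k).
  rewrite /f; case: unliftP => [u -> //|/perm_inj /eqP].
  by rewrite eq_sym (negPf (neq_lift _ _)).
have f_inj : injective f.
  by move=> x y /(congr1 (lift (s i))); rewrite !lift_f => /perm_inj/lift_inj.
exists (perm f_inj); apply/permP => x.
case: (unliftP i x) => [u|] ->; last by rewrite lift_perm_id.
by rewrite lift_perm_lift permE lift_f.
Qed.

(** The restricted lift of [s] misses exactly [i] in its domain and [j] in its image, so it can
    serve as the transporting element. *)
Lemma AOR_ideal n (i j : 'I_n.+1) b (s : 'S_n) (alpha beta : pperm n.+1) :
    alpha \in AOR n.+1 -> beta \in AOR n.+1 ->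
    ~: pdom alpha = [set i] -> ~: pdom beta = [set j] ->
    perm_orients b s -> odd_perm s = odd i (+) odd j ->
  alpha \in two_sided_ideal (AOR n.+1) beta.
Proof.
move=> alphaM betaM dom_a dom_b os odd_s.
apply: (AOR_ideal_transport (perm_restr_AOR os odd_s)) => // [x|y].
  rewrite ffunE; case: eqP => // -> _; apply/eqP.
  by have := set11 i; rewrite -dom_a !inE negbK.
move=> by0; have: y \in [set j] by rewrite -dom_b !inE by0.
move/set1P=> ->; case cj: (pinv _ j) => [x|] //; move/pinvP: cj.
rewrite ffunE; case: eqP => // ne_xi [] /eqP.
by rewrite -{2}(lift_perm_id i j s) (inj_eq perm_inj) => /eqP.
Qed.

(** If [alpha = u * beta * v], then [u] maps every point other than [i] to a point other than [j],
    so its even completion [s] sends [i] to [j]. What [s] induces on the remaining points is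
    dihedral, hence even, and the sign formula for [lift_perm] leaves [odd i = odd j]. *)
Lemma AOR_ideal_parity n (i j : 'I_n.+1) (alpha beta : pperm n.+1) :
    n = 1 %[mod 4] -> ~: pdom alpha = [set i] -> ~: pdom beta = [set j] ->
  alpha \in two_sided_ideal (AOR n.+1) beta -> odd i = odd j.
Proof.
move=> n_mod dom_a dom_b /imset2P[u v /AORP[[s even_s u_s] [b ou]] _ def_a].
have u_dom x : x != i -> u x = Some (s x) /\ s x != j.
  move=> ne_xi; have: x \in pdom alpha by rewrite -[_ \in _]negbK -in_setC dom_a inE.
  rewrite def_a inE !ffunE; case ux: (u x) => [y|] //=; rewrite (u_s _ _ ux).
  case by_: (beta y) => // _; split=> //.
  by rewrite -in_set1 -dom_b !inE by_.
have si : s i = j.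
  apply/eqP; rewrite -[j](permKV s) (inj_eq perm_inj); apply/negPn/negP => ne.
  by have [_] := u_dom (s^-1%g j) (ltac:(by rewrite eq_sym)); rewrite permKV eqxx.
have [t def_s] := lift_perm_surj s i; rewrite si in def_s.
have ot : perm_orients b t.
  move=> x y z; rewrite -(cyc_lift i) => cyc0.
  have u_lift k : u (lift i k) = Some (lift j (t k)).
    by have [] := u_dom (lift i k); rewrite ?def_s ?lift_perm_lift // eq_sym neq_lift.
  have := ou _ _ _ _ _ _ (u_lift x) (u_lift y) (u_lift z) cyc0.
  by rewrite /cycb !cyc_lift.
move: even_s; rewrite def_s odd_lift_perm (negPf (perm_orients_even n_mod ot)).
by case: (odd i); case: (odd j).
Qed.

Theorem proposition2p3 (n : nat) (n_ge4 : 4 <= n) (alpha beta : pperm n)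
    (alphaA : alpha \in AOR n) (betaA : beta \in AOR n)
    (rk_alpha : prank alpha = n - 1) (rk_beta : prank beta = n - 1) :
  (n <> 2 %[mod 4] -> Jrel (AOR n) alpha beta) /\
  (n = 2 %[mod 4] ->
     (Jrel (AOR n) alpha beta <-> odd (d alpha) = odd (d beta))).
Proof.
case: n n_ge4 alpha beta alphaA betaA rk_alpha rk_beta => // n n_ge3 alpha beta.
rewrite subn1 => alphaA betaA rk_alpha rk_beta.
have [i dom_a ->] := dP (ltn0Sn n) rk_alpha.
have [j dom_b ->] := dP (ltn0Sn n) rk_beta.
have J_of_perm b (s : 'S_n) : perm_orients b s ->
    odd_perm s = odd i (+) odd j -> Jrel (AOR n.+1) alpha beta.
  move=> os odd_s; apply/Jrel_AOR; split; first exact: AOR_ideal os odd_s.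
  by apply: (AOR_ideal betaA alphaA dom_b dom_a os); rewrite odd_s addbC.
split=> n_mod.
  (* Here [n] is one less than the size of the chain, so residue 2 becomes residue 1. *)
  have n_mod' : n <> 1 %[mod 4] by lia.
  have n_gt0 : 0 < n by lia.
  have [b [s []]] := perm_orients_parity (odd i (+) odd j) n_gt0 n_mod'.
  exact: J_of_perm.
have n_mod' : n = 1 %[mod 4] by lia.
(* The labels are [i.+1] and [j.+1]; the two shifts cancel when parities are compared. *)
split=> [/Jrel_AOR[aJb _] | /= /negb_inj eq_ij].
  by rewrite /= (AOR_ideal_parity n_mod' dom_a dom_b aJb).
apply: (J_of_perm false 1%g); last by rewrite odd_perm1 eq_ij addbb.
by move=> x y z; rewrite !perm1.
Qed.
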